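(* Let $C$ be a monoidal category with ambidextrous duals. Then for each choice of system of right duals $\star$ on $C$, there is a canonical bijection $$\{\text{even-handed structures on }C\}\;\cong\;\{\text{pivotal structures on }C\text{ with respect to }\star\}.$$ Moreover, this bijection is natural with respect to altering the system of right duals: if $\star'$ is another system of right duals, and $\gamma:\mathrm{id}\Rightarrow\star\star$, $\gamma':\mathrm{id}\Rightarrow\star'\star'$ are the pivotal structures corresponding to the same even-handed structure, then $\gamma'=\xi\circ\gamma$, where $\xi:\star\star\Rightarrow\star'\star'$ is the canonical natural isomorphism.
   Context: Associators and unit isomorphisms are suppressed. A right dual of $V$ is $(V^*,\eta,\epsilon)$ with $\eta:1\to V^*\otimes V$, $\epsilon:V\otimes V^*\to1$ satisfying the snake equations; $\mathrm{Adj}(V\dashv V^* )$ is the set of such pairs $(\eta,\epsilon)$. $C$ has ambidextrous duals if every object has a dual and all duals are two-sided. For $\theta:V\to W$ and chosen right duals, the right dagger is $\theta^\dagger=(\mathrm{id}_{V^*}\otimes\epsilon_W)(\mathrm{id}\otimes\theta\otimes\mathrm{id})(\eta_V\otimes\mathrm{id}_{W^*}):W^*\to V^*$. **Even-handed structure.** For each pair $(V,V^* )$ of dual objects, a map $\Psi:\mathrm{Adj}(V\dashv V^* )\to\mathrm{Adj}(V^*\dashv V)$ such that: (i) $\Psi^2=\mathrm{id}$; (ii) $\Psi$ sends the nested tensor product duality of $V\otimes W$ with $W^*\otimes V^*$ built from $(\eta_V,\epsilon_V),(\eta_W,\epsilon_W)$ to the one built from $\Psi(\eta_V,\epsilon_V),\Psi(\eta_W,\epsilon_W)$,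 and is the identity on the trivial duality of $1$; (iii) for every $\theta:V\to W$ and all right duals, $\theta^\dagger$ equals $(e_W\otimes\mathrm{id}_{V^*})(\mathrm{id}\otimes\theta\otimes\mathrm{id})(\mathrm{id}_{W^*}\otimes n_V)$, where $(n_V,e_V)=\Psi(\eta_V,\epsilon_V)$, $(n_W,e_W)=\Psi(\eta_W,\epsilon_W)$, with $n_V:1\to V\otimes V^*$, $e_V:V^*\otimes V\to1$. **Pivotal structure.** A system of right duals $\star$ is a choice of right dual $(V^\star,\eta_V,\epsilon_V)$ for every object $V$; with $\theta\mapsto\theta^\dagger$ on morphisms and the canonical isomorphisms $W^\star\otimes V^\star\cong(V\otimes W)^\star$ it gives a contravariant monoidal functor $\star:C\to C$. A pivotal structure with respect to $\star$ is a monoidal natural isomorphism $\gamma:\mathrm{id}\Rightarrow\star\star$ with $\gamma_{V^\star}=(\gamma_V^{-1})^\dagger$ for all $V$. **Canonical isomorphism.** For two systems $\star,\star'$ let $\delta_V:V^\star\to V^{\star'}$ be the unique isomorphism carrying $(\eta_V,\epsilon_V)$ to $(\eta'_V,\epsilon'_V)$; then $\xi_V$ is the composite $V^{\star\star}\xrightarrow{\delta_{V^\star}}(V^\star)^{\star'}\xrightarrow{(\delta_V^{-1})^\dagger}(V^{\star'})^{\star'}$ (second dagger computed with $\star'$). *)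

(* Defs.v *)
From mathcomp Require Import ssreflect ssrfun ssrbool.

Set Implicit Arguments.
Unset Strict Implicit.
Unset Printing Implicit Defensive.

Declare Scope cat_scope.
Delimit Scope cat_scope with cat.
Local Open Scope cat_scope.

Reserved Notation "A ~> B" (at level 90, right associativity).
Reserved Notation "g ∘ f" (at level 45, right associativity).
Reserved Notation "A ⊗ B" (at level 40, left associativity).
Reserved Notation "f ⊠ g" (at level 40, left associativity).
Reserved Notation "A ◁ f" (at level 39, right associativity).
Reserved Notation "f ▷ A" (at level 38, left associativity).
Reserved Notation "f ⁻¹" (at level 1, left associativity, format "f ⁻¹").

Record category := Category {
  ob :> Type;
  hom : ob -> ob -> Type;
  idm : forall A, hom A A;
  comp : forall A B D, hom B D -> hom A B -> hom A D;
  comp_idl : forall A B (f : hom A B), comp (idm B) f = f;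
  comp_idr : forall A B (f : hom A B), comp f (idm A) = f;
  compA : forall A B D E (h : hom D E) (g : hom B D) (f : hom A B),
    comp (comp h g) f = comp h (comp g f)
}.
Arguments hom {c} A B.
Arguments idm {c} A.
Arguments comp {c A B D} g f.

Notation "A ~> B" := (hom A B) : cat_scope.
Notation "g ∘ f" := (comp g f) : cat_scope.

Record iso (C : category) (A B : C) := Iso {
  iso_fun :> A ~> B;
  iso_inv : B ~> A;
  iso_funK : iso_inv ∘ iso_fun = idm A;
  iso_invK : iso_fun ∘ iso_inv = idm B
}.
Arguments iso {C} A B.

Notation "f ⁻¹" := (iso_inv f) : cat_scope.

Record monoidal_category := MonoidalCategory {
  mcat :> category;
  tens : mcat -> mcat -> mcat;
  unit_ob : mcat;
  tensh : forall A A' B B' : mcat,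
    A ~> A' -> B ~> B' -> tens A B ~> tens A' B';
  tensh_id : forall A B : mcat, tensh (idm A) (idm B) = idm (tens A B);
  tensh_comp : forall (A A' A'' B B' B'' : mcat)
    (f' : A' ~> A'') (f : A ~> A') (g' : B' ~> B'') (g : B ~> B'),
    tensh (f' ∘ f) (g' ∘ g) = tensh f' g' ∘ tensh f g;
  assoc : forall A B D : mcat, iso (tens (tens A B) D) (tens A (tens B D));
  lunit : forall A : mcat, iso (tens unit_ob A) A;
  runit : forall A : mcat, iso (tens A unit_ob) A;
  assoc_nat : forall (A A' B B' D D' : mcat)
    (f : A ~> A') (g : B ~> B') (h : D ~> D'),
    assoc A' B' D' ∘ tensh (tensh f g) h = tensh f (tensh g h) ∘ assoc A B D;
  lunit_nat : forall (A B : mcat) (f : A ~> B),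
    lunit B ∘ tensh (idm unit_ob) f = f ∘ lunit A;
  runit_nat : forall (A B : mcat) (f : A ~> B),
    runit B ∘ tensh f (idm unit_ob) = f ∘ runit A;
  pentagon : forall A B D E : mcat,
    assoc A B (tens D E) ∘ assoc (tens A B) D E
    = tensh (idm A) (assoc B D E) ∘ assoc A (tens B D) E
      ∘ tensh (assoc A B D) (idm E);
  triangle : forall A B : mcat,
    tensh (idm A) (lunit B) ∘ assoc A unit_ob B
    = tensh (runit A) (idm B)
}.
Arguments tens {m} A B.
Arguments unit_ob {m}.
Arguments tensh {m A A' B B'} f g.
Arguments assoc {m} A B D.
Arguments lunit {m} A.
Arguments runit {m} A.

Notation "A ⊗ B" := (tens A B) : cat_scope.
Notation "f ⊠ g" := (tensh f g) : cat_scope.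
Notation "A ◁ f" := (tensh (idm A) f) : cat_scope.
Notation "f ▷ A" := (tensh f (idm A)) : cat_scope.
Notation "'𝟙'" := unit_ob : cat_scope.

Section Coherence.
Variable C : monoidal_category.
Implicit Types A B D E X Y : C.

Lemma post (A B D X : C) (g : B ~> D) (f : A ~> B) (h : A ~> D) :
  g ∘ f = h -> forall x : X ~> A, g ∘ f ∘ x = h ∘ x.
Proof. by move=> <- x; rewrite compA. Qed.

Lemma isoK (A B X : C) (f : iso A B) (x : X ~> A) : f⁻¹ ∘ f ∘ x = x.
Proof. by rewrite (post (iso_funK f)) comp_idl. Qed.

Lemma isoVK (A B X : C) (f : iso A B) (x : X ~> B) : f ∘ f⁻¹ ∘ x = x.
Proof. by rewrite (post (iso_invK f)) comp_idl. Qed.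

Lemma iso_epi (A B X : C) (f : iso A B) (x y : B ~> X) :
  x ∘ f = y ∘ f -> x = y.
Proof.
move=> e; have := f_equal (fun z => z ∘ f⁻¹) e.
by rewrite !compA iso_invK !comp_idr.
Qed.

Lemma iso_mono (A B X : C) (f : iso A B) (x y : X ~> A) :
  f ∘ x = f ∘ y -> x = y.
Proof. by move=> e; rewrite -(isoK f x) e isoK. Qed.

Lemma wlD A B D E (g : D ~> E) (f : B ~> D) : A ◁ (g ∘ f) = A ◁ g ∘ A ◁ f.
Proof. by rewrite -tensh_comp comp_idl. Qed.

Lemma wrD A B D E (g : D ~> E) (f : B ~> D) : (g ∘ f) ▷ A = g ▷ A ∘ f ▷ A.
Proof. by rewrite -tensh_comp comp_idl. Qed.

Lemma xchg A B D E (f : A ~> B) (g : D ~> E) : B ◁ g ∘ f ▷ D = f ▷ E ∘ A ◁ g.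
Proof. by rewrite -!tensh_comp !comp_idl !comp_idr. Qed.

Lemma assocl A B D E (f : D ~> E) :
  assoc A B E ∘ (A ⊗ B) ◁ f = A ◁ (B ◁ f) ∘ assoc A B D.
Proof. by rewrite -tensh_id assoc_nat. Qed.

Lemma assocm A B D E (f : D ~> E) :
  assoc A E B ∘ (A ◁ f) ▷ B = A ◁ (f ▷ B) ∘ assoc A D B.
Proof. by rewrite assoc_nat. Qed.

Lemma assocr A B D E (f : D ~> E) :
  assoc E A B ∘ (f ▷ A) ▷ B = f ▷ (A ⊗ B) ∘ assoc D A B.
Proof. by rewrite assoc_nat tensh_id. Qed.

Lemma nat_inv (A A' B B' : C) (a : iso A B) (b : iso A' B') f g :
  b ∘ f = g ∘ a -> f ∘ a⁻¹ = b⁻¹ ∘ g.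
Proof.
move=> e; apply: (iso_mono (f := b)).
by rewrite isoVK (post e) compA iso_invK comp_idr.
Qed.

Lemma assoclV A B D E (f : D ~> E) :
  (A ⊗ B) ◁ f ∘ (assoc A B D)⁻¹ = (assoc A B E)⁻¹ ∘ A ◁ (B ◁ f).
Proof. exact/nat_inv/assocl. Qed.

Lemma assocmV A B D E (f : D ~> E) :
  (A ◁ f) ▷ B ∘ (assoc A D B)⁻¹ = (assoc A E B)⁻¹ ∘ A ◁ (f ▷ B).
Proof. exact/nat_inv/assocm. Qed.

Lemma assocrV A B D E (f : D ~> E) :
  (f ▷ A) ▷ B ∘ (assoc D A B)⁻¹ = (assoc E A B)⁻¹ ∘ f ▷ (A ⊗ B).
Proof. exact/nat_inv/assocr. Qed.

Lemma lunitV_nat A B (f : A ~> B) : 𝟙 ◁ f ∘ (lunit A)⁻¹ = (lunit B)⁻¹ ∘ f.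
Proof. exact/nat_inv/lunit_nat. Qed.

Lemma runitV_nat A B (f : A ~> B) : f ▷ 𝟙 ∘ (runit A)⁻¹ = (runit B)⁻¹ ∘ f.
Proof. exact/nat_inv/runit_nat. Qed.

Lemma wl_inj A B (f g : A ~> B) : 𝟙 ◁ f = 𝟙 ◁ g -> f = g.
Proof.
by move=> e; apply: (iso_epi (f := lunit A)); rewrite -!lunit_nat e.
Qed.

Lemma wr_inj A B (f g : A ~> B) : f ▷ 𝟙 = g ▷ 𝟙 -> f = g.
Proof.
by move=> e; apply: (iso_epi (f := runit A)); rewrite -!runit_nat e.
Qed.

Lemma wlK A B D (f : iso B D) : A ◁ f ∘ A ◁ f⁻¹ = idm (A ⊗ D).
Proof. by rewrite -wlD iso_invK tensh_id. Qed.

Lemma wlVK A B D (f : iso B D) : A ◁ f⁻¹ ∘ A ◁ f = idm (A ⊗ B).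
Proof. by rewrite -wlD iso_funK tensh_id. Qed.

Lemma wrK A B D (f : iso B D) : f ▷ A ∘ f⁻¹ ▷ A = idm (D ⊗ A).
Proof. by rewrite -wrD iso_invK tensh_id. Qed.

Lemma wrVK A B D (f : iso B D) : f⁻¹ ▷ A ∘ f ▷ A = idm (B ⊗ A).
Proof. by rewrite -wrD iso_funK tensh_id. Qed.

Definition wr_iso A B D (f : iso B D) : iso (B ⊗ A) (D ⊗ A) :=
  Iso (wrVK A f) (wrK A f).
Definition wl_iso A B D (f : iso B D) : iso (A ⊗ B) (A ⊗ D) :=
  Iso (wlVK A f) (wlK A f).

Lemma lunit_tens A B : lunit (A ⊗ B) ∘ assoc 𝟙 A B = lunit A ▷ B.
Proof.
apply: wl_inj; rewrite wlD.
apply: (iso_epi (f := assoc 𝟙 (𝟙 ⊗ A) B)).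
rewrite compA -[RHS]assocm.
apply: (iso_epi (f := wr_iso B (assoc 𝟙 𝟙 A))); rewrite /= !compA.
rewrite -pentagon (post (triangle _ _)) -tensh_id -assoc_nat.
by rewrite -(@triangle C 𝟙 A) wrD.
Qed.

Lemma runit_tens A B : A ◁ runit B ∘ assoc A B 𝟙 = runit (A ⊗ B).
Proof.
apply: wr_inj; rewrite wrD.
apply: (iso_mono (f := assoc A B 𝟙)).
rewrite (post (assocm _ _ _)) compA.
rewrite -(triangle (A ⊗ B) 𝟙) (post (assocl _ _ _)) compA pentagon.
by rewrite -(triangle B 𝟙) wlD !compA.
Qed.

Lemma runit1 : runit 𝟙 = lunit 𝟙 :> ((𝟙 : C) ⊗ 𝟙 ~> 𝟙).
Proof.
apply: wr_inj; rewrite -triangle -lunit_tens; congr (_ ∘ _).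
by apply: (iso_mono (f := lunit 𝟙)); rewrite lunit_nat.
Qed.

Lemma pentagonV A B D E :
  (assoc A B D) ▷ E ∘ (assoc (A ⊗ B) D E)⁻¹
  = (assoc A (B ⊗ D) E)⁻¹ ∘ (A ◁ (assoc B D E)⁻¹) ∘ assoc A B (D ⊗ E).
Proof.
apply: (iso_epi (f := assoc (A ⊗ B) D E)).
rewrite !compA iso_funK comp_idr pentagon.
by rewrite (post (wlVK _ _)) comp_idl isoK.
Qed.

End Coherence.

(** [adj V W] is the set of pairs [(η, ε)] exhibiting [W] as a right dual
    of [V]. *)
Record adj (C : monoidal_category) (V W : C) := Adj {
  coev : 𝟙 ~> W ⊗ V;
  ev : V ⊗ W ~> 𝟙;
  snakeV : lunit V ∘ ev ▷ V ∘ (assoc V W V)⁻¹ ∘ V ◁ coev ∘ (runit V)⁻¹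
           = idm V;
  snakeW : runit W ∘ W ◁ ev ∘ assoc W V W ∘ coev ▷ W ∘ (lunit W)⁻¹ = idm W
}.
Arguments adj {C} V W.

Definition ambidextrous_duals (C : monoidal_category) : Prop :=
  (forall V : C, exists W : C, inhabited (adj V W)) /\
  (forall V W : C, inhabited (adj V W) -> inhabited (adj W V)).

Section Duality.
Variable C : monoidal_category.
Implicit Types V W X Y : C.

Section CupCap.
Variables (V W : C) (d : adj V W).

Definition cap X : V ⊗ (W ⊗ X) ~> X :=
  lunit X ∘ ev d ▷ X ∘ (assoc V W X)⁻¹.
Definition cup X : X ~> W ⊗ (V ⊗ X) :=
  assoc W V X ∘ coev d ▷ X ∘ (lunit X)⁻¹.

Lemma cap_nat X Y (f : X ~> Y) : cap Y ∘ V ◁ (W ◁ f) = f ∘ cap X.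
Proof.
by rewrite /cap !compA -assoclV (post (esym (xchg _ _))) !compA
  (post (lunit_nat _)) !compA.
Qed.

Lemma cup_nat X Y (f : X ~> Y) : W ◁ (V ◁ f) ∘ cup X = cup Y ∘ f.
Proof.
by rewrite /cup !compA -lunitV_nat (post (esym (assocl _ _ _))) !compA
  (post (xchg _ _)) !compA.
Qed.

Lemma cap_tens X Y :
  cap (X ⊗ Y) ∘ V ◁ assoc W X Y ∘ assoc V (W ⊗ X) Y = cap X ▷ Y.
Proof.
rewrite /cap !wrD -lunit_tens !compA (post (assocr _ _ _)) !compA.
congr (_ ∘ _ ∘ _).
apply: (iso_epi (f := wr_iso Y (assoc V W X))) => /=.
rewrite !compA wrVK comp_idr.
by rewrite -pentagon isoK.
Qed.

Lemma cup_tens X Y :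
  cup (X ⊗ Y) = W ◁ assoc V X Y ∘ assoc W (V ⊗ X) Y ∘ cup X ▷ Y.
Proof.
rewrite /cup !wrD.
have -> : (lunit (X ⊗ Y))⁻¹ = assoc 𝟙 X Y ∘ (lunit X)⁻¹ ▷ Y.
  apply: (iso_mono (f := lunit (X ⊗ Y))).
  by rewrite iso_invK (post (lunit_tens _ _)) wrK.
rewrite (post (esym (assocr _ _ _))) !compA (post (pentagon _ _ _ _)).
by rewrite !compA.
Qed.

Lemma cap_coev : cap V ∘ V ◁ coev d ∘ (runit V)⁻¹ = idm V.
Proof. by rewrite /cap !compA snakeV. Qed.

Lemma ev_cup : W ◁ ev d ∘ cup W = (runit W)⁻¹.
Proof.
apply: (iso_mono (f := runit W)); rewrite iso_invK; exact: snakeW.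
Qed.

Lemma cap_cup X : cap (V ⊗ X) ∘ V ◁ cup X = idm (V ⊗ X).
Proof.
have e : cap V ▷ X ∘ (V ◁ coev d) ▷ X ∘ (runit V)⁻¹ ▷ X = idm (V ⊗ X).
  by rewrite -!wrD cap_coev tensh_id.
rewrite -cap_tens !compA (post (assocm _ _ _)) in e.
rewrite /cup !wlD -[RHS]e !compA; do 5 congr (_ ∘ _).
apply: (iso_mono (f := wl_iso V (lunit X))) => /=.
rewrite wlK (post (triangle _ _)) -wrD iso_invK tensh_id //.
Qed.

Lemma cup_cap X : W ◁ cap X ∘ cup (W ⊗ X) = idm (W ⊗ X).
Proof.
have e : runit W ▷ X ∘ (W ◁ ev d) ▷ X ∘ cup W ▷ X = idm (W ⊗ X).
  by rewrite -!wrD ev_cup iso_invK tensh_id.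
rewrite -[RHS]e -triangle cup_tens /cap !wlD !compA.
by rewrite (post (wlVK _ _)) comp_idl (post (assocm _ _ _)) !compA.
Qed.

Lemma ev_cap : ev d ∘ V ◁ runit W = cap 𝟙.
Proof.
apply: (iso_epi (f := assoc V W 𝟙)).
rewrite /cap !compA runit_tens iso_funK comp_idr.
by rewrite -runit_nat runit1.
Qed.

Lemma ev_inj X (f g : X ~> W) : ev d ∘ V ◁ f = ev d ∘ V ◁ g -> f = g.
Proof.
have curryK (h : X ~> W) : runit W ∘ W ◁ (ev d ∘ V ◁ h) ∘ cup X = h.
  rewrite wlD !compA cup_nat /cup !compA.
  have := f_equal (fun k => k ∘ h) (snakeW d).
  by rewrite !compA comp_idl.
by move=> e; rewrite -(curryK f) -(curryK g) e.
Qed.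

Lemma coev_inj (f g : 𝟙 ~> W ⊗ V) :
  cap V ∘ V ◁ f = cap V ∘ V ◁ g -> f = g.
Proof.
have K (h : 𝟙 ~> W ⊗ V) : W ◁ (cap V ∘ V ◁ h) ∘ cup 𝟙 = h.
  by rewrite wlD !compA cup_nat (post (cup_cap _)) comp_idl.
by move=> e; rewrite -(K f) -(K g) e.
Qed.

End CupCap.

(** The right dagger [θ† : W' ~> V'] of [θ : V ~> W] with respect to right
    duals [V'] of [V] and [W'] of [W]. *)
Definition dagger V V' W W' (dV : adj V V') (dW : adj W W') (t : V ~> W) :
    W' ~> V' :=
  runit V' ∘ V' ◁ ev dW ∘ assoc V' W W' ∘ (V' ◁ t) ▷ W' ∘ coev dV ▷ W'
  ∘ (lunit W')⁻¹.

(** The transpose of [θ : V ~> W] on the other side, with respect to dualities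
    [n_V : 𝟙 ~> V ⊗ V'], [e_V : V' ⊗ V ~> 𝟙] and likewise for [W]. *)
Definition codagger V V' W W' (dV : adj V' V) (dW : adj W' W) (t : V ~> W) :
    W' ~> V' :=
  lunit V' ∘ ev dW ▷ V' ∘ (assoc W' W V')⁻¹ ∘ W' ◁ (t ▷ V') ∘ W' ◁ coev dV
  ∘ (runit W')⁻¹.

Lemma ev_dagger V V' W W' (dV : adj V V') (dW : adj W W') (t : V ~> W) :
  ev dV ∘ V ◁ dagger dV dW t = ev dW ∘ t ▷ W'.
Proof.
have -> : dagger dV dW t = runit V' ∘ V' ◁ (ev dW ∘ t ▷ W') ∘ cup dV W'.
  by rewrite /dagger /cup wlD !compA (post (assocm _ _ _)) !compA.
move: (ev dW ∘ t ▷ W') => k.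
rewrite 2!wlD (post (ev_cap _)) (post (cap_nat _ _)) compA cap_cup.
by rewrite comp_idr.
Qed.

Lemma dagger_id V V' (d : adj V V') : dagger d d (idm V) = idm V'.
Proof.
by apply: (ev_inj (d := d)); rewrite ev_dagger !tensh_id.
Qed.

Lemma dagger_comp V V' W W' X X' (dV : adj V V') (dW : adj W W')
    (dX : adj X X') (u : W ~> X) (t : V ~> W) :
  dagger dV dW t ∘ dagger dW dX u = dagger dV dX (u ∘ t).
Proof.
apply: (ev_inj (d := dV)); rewrite wlD (post (ev_dagger _ _ _)) ev_dagger.
by rewrite compA -xchg (post (ev_dagger _ _ _)) wrD compA.
Qed.

(** The canonical isomorphism between two right duals of [V]; the lemmas
    [carries_comparison] and [comparison_unique] show that it is the unique
    morphism carrying [d] to [d']. *)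
Definition comparison_fun V W W' (d : adj V W) (d' : adj V W') : W ~> W' :=
  dagger d' d (idm V).

Lemma comparisonK V W W' (d : adj V W) (d' : adj V W') :
  comparison_fun d' d ∘ comparison_fun d d' = idm W.
Proof. by rewrite /comparison_fun dagger_comp comp_idl dagger_id. Qed.

Definition comparison V W W' (d : adj V W) (d' : adj V W') : iso W W' :=
  Iso (comparisonK d d') (comparisonK d' d).

Definition carries V W W' (d : adj V W) (d' : adj V W') (f : iso W W') : Prop :=
  f ▷ V ∘ coev d = coev d' /\ ev d ∘ V ◁ f⁻¹ = ev d'.

Lemma carries_comparison V W W' (d : adj V W) (d' : adj V W') :
  carries d d' (comparison d d').
Proof.
have evd (x : adj V W) (y : adj V W') : ev x ∘ V ◁ comparison_fun y x = ev y.
  by rewrite /comparison_fun ev_dagger tensh_id comp_idr.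
split; last exact: evd.
have evd' : ev d' ∘ V ◁ comparison_fun d d' = ev d.
  by rewrite /comparison_fun ev_dagger tensh_id comp_idr.
apply: (coev_inj (d := d')).
apply: (iso_epi (f := Iso (iso_invK (runit V)) (iso_funK (runit V)))) => /=.
rewrite wlD /cap !compA snakeV.
rewrite (post (esym (assocmV _ _ _))) compA (post (esym (wrD _ _ _))).
by rewrite evd' snakeV.
Qed.

Lemma comparison_unique V W W' (d : adj V W) (d' : adj V W') (f : iso W W') :
  carries d d' f -> f = comparison d d' :> (W ~> W').
Proof.
case=> _ e; apply: (ev_inj (d := d')).
rewrite /= /comparison_fun ev_dagger tensh_id comp_idr -e compA wlVK.
by rewrite comp_idr.
Qed.

Lemma unit_snakeV :
  lunit 𝟙 ∘ lunit 𝟙 ▷ 𝟙 ∘ (assoc 𝟙 𝟙 𝟙)⁻¹ ∘ 𝟙 ◁ (lunit 𝟙)⁻¹ ∘ (runit 𝟙)⁻¹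
  = idm (𝟙 : C).
Proof.
rewrite -runit1 -triangle !compA isoVK (post (wlK _ _)) comp_idl.
by rewrite iso_invK.
Qed.

Lemma unit_snakeW :
  runit 𝟙 ∘ 𝟙 ◁ lunit 𝟙 ∘ assoc 𝟙 𝟙 𝟙 ∘ (lunit 𝟙)⁻¹ ▷ 𝟙 ∘ (lunit 𝟙)⁻¹
  = idm (𝟙 : C).
Proof.
by rewrite (post (triangle _ _)) runit1 (post (wrK _ _)) comp_idl iso_invK.
Qed.

Definition adj_unit : adj (𝟙 : C) 𝟙 := Adj unit_snakeV unit_snakeW.

Section Nested.
Variables (V V' W W' : C) (dV : adj V V') (dW : adj W W').

Definition nested_coev : 𝟙 ~> (W' ⊗ V') ⊗ (V ⊗ W) :=
  (assoc W' V' (V ⊗ W))⁻¹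
  ∘ W' ◁ (assoc V' V W ∘ coev dV ▷ W ∘ (lunit W)⁻¹) ∘ coev dW.

Definition nested_ev : (V ⊗ W) ⊗ (W' ⊗ V') ~> 𝟙 :=
  ev dV ∘ V ◁ (lunit V' ∘ ev dW ▷ V' ∘ (assoc W W' V')⁻¹)
  ∘ assoc V W (W' ⊗ V').

Lemma nested_cap X :
  lunit X ∘ nested_ev ▷ X ∘ (assoc (V ⊗ W) (W' ⊗ V') X)⁻¹
  = cap dV X ∘ V ◁ (cap dW (V' ⊗ X) ∘ W ◁ assoc W' V' X)
    ∘ assoc V W ((W' ⊗ V') ⊗ X).
Proof.
have -> : nested_ev = ev dV ∘ V ◁ cap dW V' ∘ assoc V W (W' ⊗ V') by [].
rewrite !wrD !compA pentagonV (post (assocmV _ _ _)) !compA /cap.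
rewrite (post (esym (wlD _ _ _))) -cap_tens /cap !compA.
by rewrite iso_invK comp_idr.
Qed.

Lemma nested_cup X :
  assoc (W' ⊗ V') (V ⊗ W) X ∘ nested_coev ▷ X ∘ (lunit X)⁻¹
  = (assoc W' V' ((V ⊗ W) ⊗ X))⁻¹
    ∘ W' ◁ (V' ◁ (assoc V W X)⁻¹ ∘ cup dV (W ⊗ X)) ∘ cup dW X.
Proof.
have -> : nested_coev =
  (assoc W' V' (V ⊗ W))⁻¹ ∘ W' ◁ cup dV W ∘ coev dW by [].
apply: (iso_mono (f := assoc W' V' ((V ⊗ W) ⊗ X))); rewrite isoVK.
rewrite (post (pentagon _ _ _ _)) !compA (post (esym (wrD _ _ _))).
rewrite isoVK wrD !compA (post (assocm _ _ _)) !compA.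
by rewrite cup_tens (post (wlVK _ _)) comp_idl [in RHS]wlD !compA.
Qed.

Lemma nested_snakeV :
  lunit (V ⊗ W) ∘ nested_ev ▷ (V ⊗ W)
  ∘ (assoc (V ⊗ W) (W' ⊗ V') (V ⊗ W))⁻¹
  ∘ (V ⊗ W) ◁ nested_coev ∘ (runit (V ⊗ W))⁻¹ = idm (V ⊗ W).
Proof.
have -> : (runit (V ⊗ W))⁻¹ = (assoc V W 𝟙)⁻¹ ∘ V ◁ (runit W)⁻¹.
  apply: (iso_mono (f := runit (V ⊗ W))).
  by rewrite iso_invK -runit_tens compA isoVK wlK.
rewrite -!compA [X in (X ∘ _ ◁ nested_coev)]compA nested_cap.
have -> : nested_coev =
  (assoc W' V' (V ⊗ W))⁻¹ ∘ W' ◁ cup dV W ∘ coev dW by [].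
move: (cap_nat dW) (cap_cup dV) (cap_coev dW).
move: (cap dV) (cap dW) (cup dV) => capV capW cupV capW_nat cap_cupV capW_coev.
rewrite !compA (post (assocl _ _ _)) !compA isoVK -!wlD !compA.
rewrite (post (esym (wlD _ _ _))) isoVK (wlD W (W' ◁ _)) ?compA.
rewrite (post (capW_nat _ _ _)).
by rewrite ?compA capW_coev comp_idr cap_cupV.
Qed.

Lemma nested_snakeW :
  runit (W' ⊗ V') ∘ (W' ⊗ V') ◁ nested_ev
  ∘ assoc (W' ⊗ V') (V ⊗ W) (W' ⊗ V')
  ∘ nested_coev ▷ (W' ⊗ V') ∘ (lunit (W' ⊗ V'))⁻¹ = idm (W' ⊗ V').
Proof.
rewrite nested_cup.
have -> : nested_ev = ev dV ∘ V ◁ cap dW V' ∘ assoc V W (W' ⊗ V') by [].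
move: (cup_nat dV) (cup_cap dW) (ev_cup dV).
move: (cap dW) (cup dV) (cup dW) => capW cupV cupW cupV_nat cup_capW ev_cupV.
rewrite (post (assoclV _ _ _)) compA (post (esym (wlD _ _ _))).
rewrite (post (esym (wlD _ _ _))).
rewrite !compA iso_invK comp_idr (wlD V') compA cupV_nat.
rewrite (post ev_cupV) wlD compA cup_capW comp_idr -runit_tens !compA isoVK.
exact: wlK.
Qed.

Definition adj_tens : adj (V ⊗ W) (W' ⊗ V') :=
  Adj nested_snakeV nested_snakeW.

End Nested.
End Duality.

Record even_handed (C : monoidal_category) := EvenHanded {
  (* [adj V V'] is empty unless [(V, V')] is a pair of dual objects *)
  eh :> forall V V' : C, adj V V' -> adj V' V;
  ehK : forall (V V' : C) (d : adj V V'), eh (eh d) = d;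
  eh_tens : forall (V V' W W' : C) (dV : adj V V') (dW : adj W W'),
    eh (adj_tens dV dW) = adj_tens (eh dW) (eh dV);
  eh_unit : eh (adj_unit C) = adj_unit C;
  eh_dagger : forall (V V' W W' : C) (dV : adj V V') (dW : adj W W')
    (t : V ~> W), dagger dV dW t = codagger (eh dV) (eh dW) t
}.
Arguments eh {C} e {V V'} d.

Record dual_system (C : monoidal_category) := DualSystem {
  star : C -> C;
  star_adj : forall V : C, adj V (star V)
}.
Arguments star {C} d V.
Arguments star_adj {C} d V.

Section Pivotal.
Variables (C : monoidal_category) (S : dual_system C).
Implicit Types V W : C.
Local Notation "V '⋆'" := (star S V) (at level 1, format "V '⋆'") : cat_scope.

Definition star_map V W (t : V ~> W) : W⋆ ~> V⋆ :=
  dagger (star_adj S V) (star_adj S W) t.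

(** [star_tens] and [star_unit] are the coherence isomorphisms of the
    contravariant monoidal functor [⋆] (with [star_map] on morphisms).  Those
    of the covariant monoidal functor [⋆⋆], [star2_tens] and [star2_unit], are
    obtained by applying [⋆] to the inverse of the former. *)
Definition star_tens V W : iso (W⋆ ⊗ V⋆) (V ⊗ W)⋆ :=
  comparison (adj_tens (star_adj S V) (star_adj S W)) (star_adj S (V ⊗ W)).

Definition star_unit : iso 𝟙 (𝟙 : C)⋆ :=
  comparison (adj_unit C) (star_adj S 𝟙).

Definition star2_map V W (t : V ~> W) : V⋆⋆ ~> W⋆⋆ := star_map (star_map t).

Definition star2_tens V W : V⋆⋆ ⊗ W⋆⋆ ~> (V ⊗ W)⋆⋆ :=
  star_map (star_tens V W)⁻¹ ∘ star_tens W⋆ V⋆.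

Definition star2_unit : 𝟙 ~> (𝟙 : C)⋆⋆ :=
  star_map star_unit⁻¹ ∘ star_unit.

(** The first four fields unfold "monoidal natural isomorphism [id ⇒ ⋆⋆]". *)
Record pivotal := Pivotal {
  piv :> forall V, iso V V⋆⋆;
  piv_nat : forall V W (t : V ~> W), piv W ∘ t = star2_map t ∘ piv V;
  piv_tens : forall V W, piv (V ⊗ W) = star2_tens V W ∘ piv V ⊠ piv W :> (_ ~> _);
  piv_unit : piv 𝟙 = star2_unit :> (_ ~> _);
  piv_star : forall V, piv V⋆ = star_map (piv V)⁻¹ :> (_ ~> _)
}.

(** Given [Ψ], both [V] (via [Ψ(η_V, ε_V)]) and [V⋆⋆] are right duals of
    [V⋆]; this is the resulting isomorphism between them. *)
Definition even_handed_piv (Psi : even_handed C) V : iso V V⋆⋆ :=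
  comparison (eh Psi (star_adj S V)) (star_adj S V⋆).

End Pivotal.

Section ChangeOfSystem.
Variables (C : monoidal_category) (S S' : dual_system C).

Definition delta (V : C) : iso (star S V) (star S' V) :=
  comparison (star_adj S V) (star_adj S' V).

Definition xi (V : C) : star S (star S V) ~> star S' (star S' V) :=
  star_map S' (delta V)⁻¹ ∘ delta (star S V).

End ChangeOfSystem.

(* Main.v *)
Require Import Defs.
From mathcomp Require Import ssreflect ssrfun ssrbool.
From Stdlib Require Import ProofIrrelevance FunctionalExtensionality.
Import Defs.
Local Open Scope cat_scope.

(** Everything is a calculation with daggers.  For dualities [d] of [V] with [V']
    and [e] of [W] with [W'], the dagger of [t : V ~> W] is characterized by
    [ev d ∘ V ◁ t† = ev e ∘ t ▷ W'].  So it is functorial for arbitrary varying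
    duals ([dagger_comp]), turns tensor products around
    ([dagger_tens]), and the comparison of two right duals of [V] is the dagger
    of [idm V]; two dualities on the same pair of objects coincide as soon as
    that comparison is an identity ([adj_ext]).

    The transpose on the other side, [codagger], is inverse to the dagger of
    the flipped dualities ([dagger_codagger], [codagger_dagger]).  Hence the
    axiom [eh_dagger] of an even-handed structure [Ψ] says exactly that the
    dagger with respect to [Ψ(d)], [Ψ(e)] undoes the dagger with respect to [d], [e]
    ([eh_double_dagger]).

    Given [Ψ], the morphism [γ_V : V ~> V⋆⋆] is the dagger of the identity of
    [V⋆] relative to [Ψ(d_V)] and the chosen dual of [V⋆].  Consequently the
    dagger of [t†] relative to a [Ψ]-flipped duality and any other one is
    [γ ∘ t] ([dagger_eh_dagger]).  Each of naturality, monoidality, the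
    condition on [γ_{V⋆}], and the formula [γ' = ξ ∘ γ] is this one identity,
    read for a suitable [t].

    Conversely, given [γ] and any [d : adj V V'], the chosen duality between
    [V⋆] and [V⋆⋆] is transported along the comparison [V' ≅ V⋆] and
    [γ_V⁻¹ : V⋆⋆ ≅ V] to a duality [piv_adj d] between [V'] and [V].  The
    axioms of [γ] correspond one by one to those of [Ψ]: naturality to
    [eh_dagger], [γ_{V⋆} = (γ_V⁻¹)†] to [Ψ² = id], and the two monoidality
    conditions to [eh_tens] and [eh_unit].  The two constructions are mutually
    inverse since [eh_dagger] already determines [Ψ] on all duals of [V] by its
    value on one of them. *)

Set Implicit Arguments.
Unset Strict Implicit.
Unset Printing Implicit Defensive.

(** * Equality of structures *)

Section Extensionality.
Variable C : monoidal_category.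
Implicit Types V W X Y : C.

Definition iso_sym V W (f : iso V W) : iso W V :=
  Iso (iso_invK f) (iso_funK f).

Lemma iso_ext V W (f g : iso V W) : f = g :> (V ~> W) -> f = g.
Proof.
case: f g => [f f' fK Kf] [g g' gK Kg] /= e; subst g.
have e' : f' = g' by rewrite -(comp_idr f') -Kg -compA fK comp_idl.
by subst g'; f_equal; apply: proof_irrelevance.
Qed.

(** The evaluation determines the coevaluation, because transposition along
    [ev d] is injective and both coevaluations transpose to the identity. *)
Lemma adj_ev_ext V W (d d' : adj V W) : ev d = ev d' -> d = d'.
Proof.
move=> e.
have e' : coev d = coev d'.
  apply: (coev_inj (d := d)).
  apply: (iso_epi (f := iso_sym (runit V))) => /=.
  by rewrite /cap !compA snakeV e snakeV.
case: d d' e e' => [c1 e1 s1 t1] [c2 e2 s2 t2] /= ? ?; subst c2 e2.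
by f_equal; apply: proof_irrelevance.
Qed.

(** This reduces every equality of dualities to an equality of morphisms that
    the functoriality of the dagger can compute. *)
Lemma adj_ext V W (d d' : adj V W) : dagger d d' (idm V) = idm W -> d = d'.
Proof.
move=> e; apply: adj_ev_ext; have := ev_dagger d d' (idm V).
by rewrite e !tensh_id !comp_idr.
Qed.

Lemma even_handed_ext (P Q : even_handed C) :
  (forall V W (d : adj V W), eh P d = eh Q d) -> P = Q.
Proof.
move=> e; have {e} : @eh C P = @eh C Q.
  by do 3 (apply: functional_extensionality_dep => ?); apply: e.
case: P Q => [p p1 p2 p3 p4] [q q1 q2 q3 q4] /= e; subst q.
by f_equal; apply: proof_irrelevance.
Qed.

Lemma pivotal_ext (S : dual_system C) (P Q : pivotal S) :
  (forall V, piv P V = piv Q V :> (V ~> star S (star S V))) -> P = Q.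
Proof.
move=> e; have {e} : @piv C S P = @piv C S Q.
  by apply: functional_extensionality_dep => V; apply/iso_ext/e.
case: P Q => [p p1 p2 p3 p4] [q q1 q2 q3 q4] /= e; subst q.
by f_equal; apply: proof_irrelevance.
Qed.

End Extensionality.

(** * Calculus of daggers *)

Section DaggerCalculus.
Variable C : monoidal_category.
Implicit Types V W X Y : C.

Lemma codaggerE V V' W W' (dV : adj V' V) (dW : adj W' W) (t : V ~> W) :
  codagger dV dW t = cap dW V' ∘ W' ◁ (t ▷ V' ∘ coev dV) ∘ (runit W')⁻¹.
Proof. by rewrite /codagger /cap wlD !compA. Qed.

(** Moving [u] through [ev dW] turns it into [u ▷ V], which slides past
    [coev dV]; what remains is a snake. *)
Lemma codagger_dagger V V' W W' (dV : adj V' V) (dW : adj W' W)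
    (u : W' ~> V') :
  codagger dV dW (dagger dW dV u) = u.
Proof.
rewrite /codagger (post (esym (assocmV _ _ _))) !compA.
rewrite (post (esym (wrD _ _ _))) ev_dagger wrD !compA.
rewrite (post (assocrV _ _ _)) !compA (post (esym (xchg _ _))) !compA.
by rewrite runitV_nat -[RHS]comp_idl -[X in _ = X ∘ _](snakeV dV) !compA.
Qed.

(** [t] can be read off from [t ▷ V' ∘ coev dV] by the snake for [dV], and
    the latter from [codagger dV dW t] by transposition along [dW]. *)
Lemma codagger_inj V V' W W' (dV : adj V' V) (dW : adj W' W) (t s : V ~> W) :
  codagger dV dW t = codagger dV dW s -> t = s.
Proof.
have recover (h : V ~> W) : runit W ∘ W ◁ ev dV ∘ assoc W V' V
    ∘ (h ▷ V' ∘ coev dV) ▷ V ∘ (lunit V)⁻¹ = h.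
  rewrite wrD !compA (post (assocr _ _ _)) !compA (post (xchg _ _)) !compA.
  rewrite (post (runit_nat _)) !compA -[RHS]comp_idr.
  by rewrite -[X in _ = _ ∘ X](snakeW dV).
rewrite !codaggerE => e.
suff es : t ▷ V' ∘ coev dV = s ▷ V' ∘ coev dV.
  by rewrite -(recover t) es recover.
have K (h : 𝟙 ~> W ⊗ V') : W ◁ (cap dW V' ∘ W' ◁ h) ∘ cup dW 𝟙 = h.
  by rewrite wlD !compA cup_nat (post (cup_cap _ _)) comp_idl.
suff es : cap dW V' ∘ W' ◁ (t ▷ V' ∘ coev dV)
          = cap dW V' ∘ W' ◁ (s ▷ V' ∘ coev dV) by rewrite -[LHS]K es K.
apply: (iso_epi (f := iso_sym (runit W'))) => /=.
by rewrite (compA (cap dW V')) e compA.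
Qed.

Lemma dagger_codagger V V' W W' (dV : adj V' V) (dW : adj W' W)
    (t : V ~> W) :
  dagger dW dV (codagger dV dW t) = t.
Proof.
by apply: (codagger_inj (dV := dV) (dW := dW)); rewrite codagger_dagger.
Qed.

(** Both sides have the same composite with the nested evaluation: the inner
    evaluation absorbs the dagger of [t] and the outer one that of [s]. *)
Lemma dagger_tens V V' W W' X X' Y Y' (dV : adj V V') (dW : adj W W')
    (dX : adj X X') (dY : adj Y Y') (s : V ~> X) (t : W ~> Y) :
  dagger (adj_tens dV dW) (adj_tens dX dY) (s ⊠ t)
  = dagger dW dY t ⊠ dagger dV dX s.
Proof.
apply: (ev_inj (d := adj_tens dV dW)); rewrite ev_dagger.
have -> : ev (adj_tens dV dW)
  = ev dV ∘ V ◁ cap dW V' ∘ assoc V W (W' ⊗ V') by [].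
have -> : ev (adj_tens dX dY)
  = ev dX ∘ X ◁ cap dY X' ∘ assoc X Y (Y' ⊗ X') by [].
(* The inner evaluation exchanges [t'] for [t] and lets [s'] pass. *)
have cap_mate (t' : Y' ~> W') (s' : X' ~> V') :
    ev dW ∘ W ◁ t' = ev dY ∘ t ▷ Y' ->
  cap dW V' ∘ W ◁ (t' ⊠ s') = s' ∘ cap dY X' ∘ t ▷ (Y' ⊗ X').
  move=> e.
  have -> : t' ⊠ s' = t' ▷ V' ∘ Y' ◁ s'.
    by rewrite -tensh_comp comp_idl comp_idr.
  rewrite (wlD W (t' ▷ _)) /cap !compA (post (esym (assocmV _ _ _))) !compA.
  rewrite (post (esym (wrD _ _ _))) e wrD !compA.
  rewrite (post (assocrV _ _ _)) !compA -(xchg t (Y' ◁ s')).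
  rewrite (post (esym (assoclV _ _ _))) !compA.
  by rewrite (post (esym (xchg _ _))) !compA (post (lunit_nat _)) !compA.
rewrite !compA assocl (post (esym (wlD _ _ _))) cap_mate ?ev_dagger //.
rewrite assoc_nat 2!(wlD V) !compA (post (ev_dagger _ _ _)) !compA.
rewrite (post (esym (xchg _ _))) !compA; do 2 congr (_ ∘ _).
by rewrite -(compA (s ▷ _)) -tensh_comp comp_idl comp_idr.
Qed.

(** [g⁻¹ ∘ g] cancels inside the snake, which leaves the snake of [X] for [d],
    conjugated by [f].  In the other snake [f] and [g] exchange their roles. *)
Lemma transport_snakeV V W X Y (d : adj X Y) (f : iso V X) (g : iso Y W) :
  lunit V ∘ (ev d ∘ f ⊠ g⁻¹) ▷ V ∘ (assoc V W V)⁻¹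
    ∘ V ◁ (g ⊠ f⁻¹ ∘ coev d) ∘ (runit V)⁻¹ = idm V.
Proof.
rewrite wrD wlD !compA.
have -> : (f ⊠ g⁻¹) ▷ V ∘ (assoc V W V)⁻¹ ∘ V ◁ (g ⊠ f⁻¹)
  ∘ V ◁ coev d ∘ (runit V)⁻¹
  = (X ⊗ Y) ◁ f⁻¹ ∘ (assoc X Y X)⁻¹ ∘ X ◁ coev d ∘ (runit X)⁻¹ ∘ f.
  rewrite -runitV_nat (post (xchg _ _)) compA (post (assoclV _ _ _)) compA.
  apply: (iso_mono (f := assoc X Y V)).
  rewrite isoVK (post (assoc_nat _ _ _)) !compA isoVK.
  do 4 rewrite (post (esym (tensh_comp _ _ _ _))).
  by rewrite -tensh_comp iso_funK !comp_idl !comp_idr.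
rewrite (post (esym (xchg _ _))) !compA (post (lunit_nat _)) !compA.
have := f_equal (fun k => f⁻¹ ∘ k ∘ f) (snakeV d).
by rewrite !compA comp_idl iso_funK.
Qed.

Lemma transport_snakeW V W X Y (d : adj X Y) (f : iso V X) (g : iso Y W) :
  runit W ∘ W ◁ (ev d ∘ f ⊠ g⁻¹) ∘ assoc W V W
    ∘ (g ⊠ f⁻¹ ∘ coev d) ▷ W ∘ (lunit W)⁻¹ = idm W.
Proof.
rewrite wrD wlD !compA (post (assoc_nat _ _ _)) !compA.
have -> : W ◁ (f ⊠ g⁻¹) ∘ g ⊠ (f⁻¹ ▷ W) ∘ assoc Y X W
    ∘ coev d ▷ W ∘ (lunit W)⁻¹
  = g ▷ (X ⊗ Y) ∘ assoc Y X Y ∘ coev d ▷ Y ∘ (lunit Y)⁻¹ ∘ g⁻¹.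
  rewrite -lunitV_nat (post (esym (xchg _ _))) compA.
  rewrite (post (assocl _ _ _)) compA.
  do 2 rewrite (post (esym (tensh_comp _ _ _ _))).
  by rewrite -tensh_comp iso_invK !comp_idl !comp_idr.
rewrite (post (xchg _ _)) !compA (post (runit_nat _)) !compA.
have := f_equal (fun k => g ∘ k ∘ g⁻¹) (snakeW d).
by rewrite !compA comp_idl iso_invK.
Qed.

Definition transport V W X Y (d : adj X Y) (f : iso V X) (g : iso Y W) :
    adj V W :=
  Adj (transport_snakeV d f g) (transport_snakeW d f g).

(** This and the next lemma are the interface to [transport]: a calculation with
    daggers never has to look at its evaluation and coevaluation. *)
Lemma dagger_transportl V W X Y Z Z' (d : adj X Y) (f : iso V X) (g : iso Y W)
    (e : adj Z Z') (t : V ~> Z) :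
  dagger (transport d f g) e t = g ∘ dagger d e (t ∘ f⁻¹).
Proof.
apply: (ev_inj (d := transport d f g)); rewrite ev_dagger /= compA.
rewrite -tensh_comp comp_idr isoK.
have -> : f ⊠ dagger d e (t ∘ f⁻¹) = X ◁ dagger d e (t ∘ f⁻¹) ∘ f ▷ Z'.
  by rewrite -tensh_comp comp_idl comp_idr.
by rewrite (post (ev_dagger _ _ _)) compA -wrD compA iso_funK comp_idr.
Qed.

Lemma dagger_transportr V W X Y Z Z' (d : adj X Y) (f : iso V X) (g : iso Y W)
    (e : adj Z Z') (t : Z ~> V) :
  dagger e (transport d f g) t = dagger e d (f ∘ t) ∘ g⁻¹.
Proof.
apply: (ev_inj (d := e)); rewrite ev_dagger wlD (post (ev_dagger _ _ _)) /=.
by rewrite !compA -!tensh_comp comp_idl !comp_idr.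
Qed.

End DaggerCalculus.

(** * From even-handed to pivotal structures *)

Section EvenHandedToPivotal.
Variables (C : monoidal_category) (Psi : even_handed C).
Implicit Types V W X : C.

(** This is [eh_dagger], restated using that [codagger] inverts the dagger of
    the flipped dualities. *)
Lemma eh_double_dagger V V' W W' (dV : adj V V') (dW : adj W W') (t : V ~> W) :
  dagger (eh Psi dW) (eh Psi dV) (dagger dV dW t) = t.
Proof.
by rewrite -[RHS](dagger_codagger (eh Psi dV) (eh Psi dW)) -eh_dagger.
Qed.

(** The right-hand side is [γ_W ∘ t], for the [γ_W] computed with the dual [X]
    of [W'].  Taking [t] to be a comparison of duals gives independence of the
    choices; taking it arbitrary gives naturality. *)
Lemma dagger_eh_dagger V V' W W' X (dV : adj V V') (dW : adj W W')
    (a : adj W' X) (t : V ~> W) :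
  dagger a (eh Psi dV) (dagger dV dW t) = dagger a (eh Psi dW) (idm W') ∘ t.
Proof.
by rewrite -{2}(eh_double_dagger dV dW t) dagger_comp comp_idr.
Qed.

Variable S : dual_system C.

Lemma even_handed_piv_nat V W (t : V ~> W) :
  even_handed_piv S Psi W ∘ t = star2_map S t ∘ even_handed_piv S Psi V.
Proof.
rewrite /= /comparison_fun /star2_map /star_map dagger_comp comp_idl.
by rewrite -(dagger_eh_dagger (star_adj S V)).
Qed.

(** Expanding the right-hand side produces the nested duality of [Ψ(d_W)]
    and [Ψ(d_V)], which [eh_tens] recognises as [Ψ] of that of [d_V] and [d_W];
    the rest compares the latter with the chosen duality of [V ⊗ W]. *)
Lemma even_handed_piv_tens V W :
  even_handed_piv S Psi (V ⊗ W) = star2_tens S V W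
    ∘ even_handed_piv S Psi V ⊠ even_handed_piv S Psi W :> (_ ~> _).
Proof.
rewrite /star2_tens /star_map /= /comparison_fun -dagger_tens tensh_id.
by rewrite -eh_tens 2!dagger_comp !comp_idl dagger_eh_dagger comp_idr.
Qed.

Lemma even_handed_piv_unit :
  even_handed_piv S Psi 𝟙 = star2_unit S :> (_ ~> _).
Proof.
rewrite /star2_unit /star_map /= /comparison_fun dagger_comp comp_idl.
rewrite -[X in dagger _ X (dagger _ _ _)](eh_unit Psi).
by rewrite dagger_eh_dagger comp_idr.
Qed.

(** [Ψ² = id] lets the chosen duality of [V] be seen as a [Ψ]-flipped one, so
    that [dagger_eh_dagger] applies at the object [V⋆]. *)
Lemma even_handed_piv_star V :
  even_handed_piv S Psi (star S V)
  = star_map S (even_handed_piv S Psi V)⁻¹ :> (_ ~> _).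
Proof.
rewrite /star_map /= /comparison_fun -[X in dagger _ X (dagger _ _ _)](ehK Psi).
by rewrite dagger_eh_dagger comp_idr.
Qed.

Definition pivotal_of_even_handed : pivotal S :=
  Pivotal even_handed_piv_nat even_handed_piv_tens even_handed_piv_unit
    even_handed_piv_star.

Lemma even_handed_piv_change (S' : dual_system C) V :
  even_handed_piv S' Psi V = xi S S' V ∘ even_handed_piv S Psi V :> (_ ~> _).
Proof.
rewrite /xi /star_map /= /comparison_fun 2!dagger_comp !comp_idl.
by rewrite dagger_eh_dagger comp_idr.
Qed.

End EvenHandedToPivotal.

(** * From pivotal to even-handed structures *)

Section PivotalToEvenHanded.
Variables (C : monoidal_category) (S : dual_system C) (gamma : pivotal S).
Implicit Types V W X : C.

Definition piv_adj V V' (d : adj V V') : adj V' V :=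
  transport (star_adj S (star S V)) (comparison d (star_adj S V))
    (iso_sym (piv gamma V)).

Lemma dagger_piv_adjl V V' X X' (d : adj V V') (e : adj X X') (t : V' ~> X) :
  dagger (piv_adj d) e t = (piv gamma V)⁻¹
    ∘ dagger (star_adj S (star S V)) e (t ∘ dagger d (star_adj S V) (idm V)).
Proof. exact: dagger_transportl. Qed.

Lemma dagger_piv_adjr V V' X X' (d : adj V V') (e : adj X X') (t : X ~> V') :
  dagger e (piv_adj d) t
  = dagger e (star_adj S (star S V)) (dagger (star_adj S V) d (idm V) ∘ t)
    ∘ piv gamma V.
Proof. exact: dagger_transportr. Qed.

(** Once the comparisons with the chosen duals are absorbed, the left-hand side
    is [γ_W⁻¹ ∘ t†† ∘ γ_V], so this is naturality of [γ]. *)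
Lemma piv_adj_double_dagger V V' W W' (dV : adj V V') (dW : adj W W')
    (t : V ~> W) :
  dagger (piv_adj dW) (piv_adj dV) (dagger dV dW t) = t.
Proof.
rewrite dagger_piv_adjl dagger_piv_adjr !dagger_comp comp_idl comp_idr.
by have := piv_nat gamma t; rewrite /star2_map /star_map => <-; rewrite isoK.
Qed.

Lemma piv_adj_dagger V V' W W' (dV : adj V V') (dW : adj W W') (t : V ~> W) :
  dagger dV dW t = codagger (piv_adj dV) (piv_adj dW) t.
Proof.
by rewrite -{2}(piv_adj_double_dagger dV dW t) codagger_dagger.
Qed.

Lemma star_piv_piv V :
  star_map S (piv gamma V) ∘ piv gamma (star S V) = idm (star S V).
Proof. by rewrite piv_star /star_map dagger_comp iso_funK dagger_id. Qed.

(** With [delta : V' ~> V⋆] the comparison, the composite to be computed is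
    [delta⁻¹ ∘ (γ_V)† ∘ delta†† ∘ γ_V'].  Naturality moves [γ] to the left of
    [delta], where it cancels against [(γ_V)†]. *)
Lemma piv_adjK V V' (d : adj V V') : piv_adj (piv_adj d) = d.
Proof.
apply/esym/adj_ext; rewrite dagger_piv_adjr comp_idr dagger_piv_adjr comp_idr.
set delta := dagger (star_adj S V) d (idm V).
have -> : dagger d (star_adj S (star S V'))
    (dagger (star_adj S V') (star_adj S (star S V)) delta ∘ piv gamma V)
  = dagger d (star_adj S V) (idm V) ∘ star_map S (piv gamma V)
    ∘ star2_map S delta.
  by rewrite /star2_map /star_map !dagger_comp comp_idr.
rewrite (compA (dagger d _ _)) (compA (star_map S _)) -piv_nat.
rewrite (post (star_piv_piv _)) comp_idl.
by rewrite /delta dagger_comp comp_idl dagger_id.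
Qed.

(** The comparison of the nested duality of [dV] and [dW] with the chosen one
    factors through the nested duality of the chosen ones.  The first factor
    reduces to [γ_V ⊠ γ_W] and the second to the structure map of [⋆⋆], so that
    monoidality of [γ] applies. *)
Lemma piv_adj_tens V V' W W' (dV : adj V V') (dW : adj W W') :
  piv_adj (adj_tens dV dW) = adj_tens (piv_adj dW) (piv_adj dV).
Proof.
apply: adj_ext; rewrite dagger_piv_adjl comp_idl.
have -> : dagger (adj_tens dV dW) (star_adj S (V ⊗ W)) (idm (V ⊗ W))
  = dagger dW (star_adj S W) (idm W) ⊠ dagger dV (star_adj S V) (idm V)
    ∘ (star_tens S V W)⁻¹.
  by rewrite -dagger_tens tensh_id /= /comparison_fun dagger_comp comp_idl.
have -> : dagger (star_adj S (star S (V ⊗ W)))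
    (adj_tens (piv_adj dW) (piv_adj dV))
    (dagger dW (star_adj S W) (idm W) ⊠ dagger dV (star_adj S V) (idm V)
     ∘ (star_tens S V W)⁻¹)
  = star2_tens S V W ∘ piv gamma V ⊠ piv gamma W.
  rewrite -(dagger_comp _ (adj_tens (star_adj S (star S W))
                                     (star_adj S (star S V)))).
  rewrite dagger_tens !dagger_piv_adjr !dagger_comp !comp_idl !dagger_id.
  rewrite !comp_idl.
  by rewrite /star2_tens /star_map /= /comparison_fun dagger_comp comp_idl.
by rewrite -piv_tens iso_funK.
Qed.

Lemma piv_adj_unit : piv_adj (adj_unit C) = adj_unit C.
Proof.
apply: adj_ext; rewrite dagger_piv_adjl comp_idl.
apply: (iso_mono (f := piv gamma 𝟙)); rewrite isoVK comp_idr piv_unit.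
by rewrite /star2_unit /star_map /= /comparison_fun dagger_comp comp_idl.
Qed.

Definition even_handed_of_pivotal : even_handed C :=
  EvenHanded piv_adjK piv_adj_tens piv_adj_unit piv_adj_dagger.

End PivotalToEvenHanded.

(** * The bijection *)

(** Comparing [Ψ(d)] with the reconstructed duality gives a double dagger
    through the chosen dual of [V], which [eh_double_dagger] collapses. *)
Lemma pivotal_of_even_handedK (C : monoidal_category) (S : dual_system C)
    (Psi : even_handed C) :
  even_handed_of_pivotal (pivotal_of_even_handed Psi S) = Psi.
Proof.
apply: even_handed_ext => V V' d /=; apply/esym/adj_ext.
rewrite dagger_piv_adjr comp_idr /= /comparison_fun.
by rewrite dagger_comp comp_idl eh_double_dagger.
Qed.

Lemma even_handed_of_pivotalK (C : monoidal_category) (S : dual_system C)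
    (gamma : pivotal S) :
  pivotal_of_even_handed (even_handed_of_pivotal gamma) S = gamma.
Proof.
apply: pivotal_ext => V /=; rewrite /comparison_fun.
by rewrite dagger_piv_adjr !dagger_id comp_idl dagger_id comp_idl.
Qed.

Theorem proposition5p7 (C : monoidal_category) (hC : ambidextrous_duals C) :
  exists Phi : forall S : dual_system C, even_handed C -> pivotal S,
    [/\ forall S : dual_system C, bijective (Phi S),
        forall (S : dual_system C) (Psi : even_handed C) (V : C),
          piv (Phi S Psi) V = even_handed_piv S Psi V
            :> (V ~> star S (star S V))
      & forall (S S' : dual_system C) (Psi : even_handed C) (V : C),
          piv (Phi S' Psi) V = xi S S' V ∘ piv (Phi S Psi) V
            :> (V ~> star S' (star S' V))].
Proof.
exists (fun S Psi => pivotal_of_even_handed Psi S); split=> // [S|S S' Psi V].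
  exists (@even_handed_of_pivotal C S).
    exact: pivotal_of_even_handedK.
  exact: even_handed_of_pivotalK.
exact: even_handed_piv_change.
Qed.
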